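(* For any positive integer $n$ we have $$\lim_{d\to\infty} e(n,B_d) = 1,$$ where $B_d$ is the unit ball of $C^\infty([0,1]^d)$ and $e(n,B_d)$ is the $n$th minimal worst case error of multivariate integration over $B_d$.
   Context: For a positive integer $d$, let $F_d = C^\infty([0,1]^d)$ be the space of real functions defined on the unit cube $[0,1]^d$ that are infinitely differentiable, with the norm $$\|f\|_d=\sup\{|D^{\alpha}f(x)| : x\in[0,1]^d,\ \alpha \text{ any multiindex}\},$$ where $\alpha=[\alpha_1,\ldots,\alpha_d]$ has non-negative integer entries (including $\alpha=0$), $|\alpha|=\alpha_1+\cdots+\alpha_d$, and $D^\alpha f=\frac{\partial^{|\alpha|}}{\partial x_1^{\alpha_1}\cdots\partial x_d^{\alpha_d}}f$. Let $B_d$ denote the unit ball of this space, i.e. the set of infinitely differentiable $f:[0,1]^d\to\mathbb{R}$ with $\|f\|_d\le 1$ (all partial derivatives of all orders, including $f$ itself, are bounded by one in absolute value on $[0,1]^d$). For $f\in B_d$ let $I_d(f)=\int_{[0,1]^d} f(t)\,dt$ (Lebesgue measure). A linear algorithm using $n$ function values is a map $A_{n,d}(f)=\sum_{j=1}^n a_j f(x_j)$ with real coefficients $a_1,\ldots,a_n$ and sample points $x_1,\ldots,x_n\in[0,1]^d$; let $\mathrm{LIN}_{n,d}$ be the class of all such algorithms. The worst case error of $A_{n,d}$ is $$\mathrm{err}(A_{n,d})=\sup\{|I_d(f)-A_{n,d}(f)| : f\in B_d\},$$ and the $n$th minimal error is $$e(n,B_d)=\inf\{\mathrm{err}(A_{n,d})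 : A_{n,d}\in\mathrm{LIN}_{n,d}\}.$$ *)

(* Defs.v *)
From HB Require Import structures.
From mathcomp Require Import all_boot all_order all_algebra.
From mathcomp Require Import all_classical all_reals all_analysis.
Set Implicit Arguments.
Unset Strict Implicit.
Unset Printing Implicit Defensive.
Import Order.TTheory GRing.Theory Num.Theory.
Import numFieldNormedType.Exports.
Local Open Scope classical_set_scope.
Local Open Scope ring_scope.

(* The library has a product sigma-algebra on d.-tuple R
   but no d-dimensional Lebesgue measure; it is the d-fold product of
   lebesgue_measure, transported along (x, t) |-> x :: t. The values on boxes,
   which characterize it, are given by lebesgue_tuple_box. *)
Section lebesgue_tuple.
Context {R : realType}.
Local Open Scope ereal_scope.

Definition tuple_cons d (p : measurableTypeR R * d.-tuple R) : d.+1.-tuple R :=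
  [tuple of p.1 :: p.2].

Fixpoint lebesgue_tuple d : set (d.-tuple R) -> \bar R :=
  match d with
  | 0 => \d_[tuple]
  | d'.+1 =>
      pushforward (lebesgue_measure \x @lebesgue_tuple d') (@tuple_cons d')
  end.

Definition tuple_uncons d (t : d.+1.-tuple R) : measurableTypeR R * d.-tuple R :=
  (thead t, [tuple of behead t]).

Lemma tuple_consK d : cancel (@tuple_cons d) (@tuple_uncons d).
Proof. by move=> [x t]; congr pair; apply/val_inj. Qed.

Lemma tuple_unconsK d : cancel (@tuple_uncons d) (@tuple_cons d).
Proof. by move=> t; rewrite [RHS]tuple_eta. Qed.

Lemma measurable_tuple_cons d :
  measurable_fun [set: measurableTypeR R * d.-tuple R] (@tuple_cons d).
Proof.
apply: measurable_cons; last exact: measurable_snd.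
by move=> _ Y mY; exact: (@measurable_fst _ _ (measurableTypeR R)).
Qed.

Lemma measurable_tuple_uncons d :
  measurable_fun [set: d.+1.-tuple R] (@tuple_uncons d).
Proof.
apply: measurable_fun_pair; last exact: measurable_behead.
by move=> _ Y mY; exact: (@measurable_tnth _ R).
Qed.

Let sigma_finite_product d1 d2 (T1 : measurableType d1)
    (T2 : measurableType d2) (m1 : {measure set T1 -> \bar R})
    (m2 : {sigma_finite_measure set T2 -> \bar R}) :
  sigma_finite setT m1 -> sigma_finite setT m2 -> sigma_finite setT (m1 \x m2).
Proof.
move=> /sigma_finiteP[F [TF ndF Foo]] /sigma_finiteP[G [TG ndG Goo]].
exists (fun n => F n `*` G n).
  rewrite -setXTT TF TG predeqE => -[x y]; split.
    move=> [/= [n _ Fnx] [k _ Gky]]; exists (maxn n k) => //; split.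
      by move: x Fnx; exact/subsetPset/ndF/leq_maxl.
    by move: y Gky; exact/subsetPset/ndG/leq_maxr.
  by move=> [n _ []/= ? ?]; split; exists n.
move=> k; have [? ?] := Foo k; have [? ?] := Goo k; split.
  exact: measurableX.
by rewrite /= product_measure1E// lte_mul_pinfty// ge0_fin_numE.
Qed.

Let lebesgue_tuple_bundled d :
  exists mu : {sigma_finite_measure set (d.-tuple R) -> \bar R},
    @lebesgue_tuple d = mu.
Proof.
elim: d => [|d [mu /= ->]]; first by exists (\d_([tuple] : 0.-tuple R)).
pose m : {measure set (d.+1.-tuple R) -> \bar R} :=
  measure_function_pushforward__canonical__measure_function_Measure
    (lebesgue_measure \x mu) (@measurable_tuple_cons d).
have sf : sigma_finite setT m.
  have [F FT mF] :=
    sigma_finite_product (sigma_finiteT lebesgue_measure) (sigma_finiteT mu).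
  exists (fun n => @tuple_uncons d @^-1` F n).
    by rewrite -preimage_bigcup -FT preimage_setT.
  move=> n; have [mFn Fnoo] := mF n; split.
    by rewrite -[X in measurable X]setTI; exact: measurable_tuple_uncons.
  rewrite /m /= /pushforward -comp_preimage.
  by rewrite (_ : _ \o _ = id)//; apply/funext => p /=; rewrite tuple_consK.
pose mS := Measure_isSigmaFinite.Build _ _ _ m sf.
pose z : {sigma_finite_measure set _ -> \bar R} :=
  HB.pack (m : set _ -> \bar R) m mS.
by exists z.
Qed.

Let lebesgue_tuple0 d : lebesgue_tuple (@set0 (d.-tuple R)) = 0.
Proof. by have [mu ->] := lebesgue_tuple_bundled d; exact: measure0. Qed.

Let lebesgue_tuple_ge0 d (A : set (d.-tuple R)) : 0 <= lebesgue_tuple A.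
Proof. by have [mu ->] := lebesgue_tuple_bundled d; exact: measure_ge0. Qed.

Let lebesgue_tuple_sigma_additive d : semi_sigma_additive (@lebesgue_tuple d).
Proof.
have [mu ->] := lebesgue_tuple_bundled d.
exact: measure_semi_sigma_additive.
Qed.

HB.instance Definition _ d := isMeasure.Build _ _ _ (@lebesgue_tuple d)
  (@lebesgue_tuple0 d) (@lebesgue_tuple_ge0 d)
  (@lebesgue_tuple_sigma_additive d).

Let lebesgue_tuple_sigma_finite d : sigma_finite setT (@lebesgue_tuple d).
Proof.
by have [mu ->] := lebesgue_tuple_bundled d; exact: sigma_finiteT.
Qed.

HB.instance Definition _ d := Measure_isSigmaFinite.Build _ _ _
  (@lebesgue_tuple d) (@lebesgue_tuple_sigma_finite d).

Lemma lebesgue_tuple_box d (A : 'I_d -> set R) :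
    (forall i, measurable (A i)) ->
  lebesgue_tuple [set t : d.-tuple R | forall i, A i (tnth t i)] =
  \prod_(i < d) lebesgue_measure (A i).
Proof.
elim: d A => [|d IH] A mA.
  by rewrite big_ord0 /= diracE mem_set// => -[].
have mB : measurable
    [set t : d.-tuple R | forall i, A (lift ord0 i) (tnth t i)].
  rewrite [X in measurable X](_ : _ = \bigcap_(i in [set: 'I_d])
      ((@tnth _ R ^~ i) @^-1` A (lift ord0 i))).
    apply: fin_bigcap_measurable => // i _.
    by rewrite -[X in measurable X]setTI; exact: measurable_tnth.
  by apply/seteqP; split=> t /= h i; [move=> _; exact: h|exact: (h i I)].
rewrite big_ord_recl -IH//.
rewrite -[RHS](product_measure1E lebesgue_measure (@lebesgue_tuple d)
  (mA ord0) mB).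
rewrite /= /pushforward; congr (_ _); apply/seteqP; split => -[x t] /=.
  move=> At; split=> [|i]; first exact: (At ord0).
  by have := At (lift ord0 i); rewrite tnthS.
move=> [Ax At] i; case: (unliftP ord0 i) => [j ->|->//].
by rewrite tnthS; exact: At.
Qed.

End lebesgue_tuple.
Arguments lebesgue_tuple {R} d _.

Section Cinf_cube.
Context {R : realType} {d : nat}.
Implicit Types (f : 'rV[R]_d -> R) (x : 'rV[R]_d).

Definition cube : set 'rV[R]_d := [set x | forall i, 0 <= x ord0 i <= 1].

(* Functions on the cube are represented by total functions on R^d, of which
   only the values on the cube are used: the difference quotients only visit
   points of the cube, so that the derivative is one-sided on the faces. *)
Definition partial_quotient f x i (h : R) : R :=
  h^-1 * (f (x + h *: delta_mx ord0 i) - f x).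

Definition partial_dom x i : set R :=
  [set h | cube (x + h *: delta_mx ord0 i)].

Definition partial_derivable f x i : Prop :=
  cvg (partial_quotient f x i @ within (partial_dom x i) 0^').

Definition partial i f x : R :=
  lim (partial_quotient f x i @ within (partial_dom x i) 0^').

Definition partials (s : seq 'I_d) f : 'rV[R]_d -> R := foldr partial f s.

Definition Cinf f : Prop := forall s : seq 'I_d,
  {within cube, continuous (partials s f)} /\
  (forall x i, cube x -> partial_derivable (partials s f) x i).

(* D^alpha: (alpha i)-fold differentiation in each coordinate i, as d/dx_1
   ... d/dx_d applied from the right; on Cinf the order does not matter. *)
Definition multi_partial (alpha : 'I_d -> nat) f : 'rV[R]_d -> R :=
  partials (flatten [seq nseq (alpha i) i | i <- enum 'I_d]) f.

Definition Cinf_norm f : \bar R :=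
  ereal_sup [set `|multi_partial p.1 f p.2|%:E
            | p in [set p : ('I_d -> nat) * 'rV[R]_d | cube p.2]].

Definition Cinf_ball : set ('rV[R]_d -> R) :=
  [set f | Cinf f /\ (Cinf_norm f <= 1)%E].

Definition row_of_tuple (t : d.-tuple R) : 'rV[R]_d := \row_i tnth t i.

Definition cube_integral f : R :=
  \int[lebesgue_tuple d]_(t in row_of_tuple @^-1` cube) f (row_of_tuple t).

Definition linear_algorithm n : set (('rV[R]_d -> R) -> R) :=
  [set A | exists (a : 'I_n -> R) (x : 'I_n -> 'rV[R]_d),
    (forall j, cube (x j)) /\ A = fun f => \sum_(j < n) a j * f (x j)].

(* Sup and inf are taken in \bar R, so that they need no boundedness proofs. *)
Definition worst_case_error (A : ('rV[R]_d -> R) -> R) : \bar R :=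
  ereal_sup [set `|cube_integral f - A f|%:E | f in Cinf_ball].

End Cinf_cube.

Definition minimal_error (R : realType) (n d : nat) : \bar R :=
  ereal_inf [set worst_case_error A | A in @linear_algorithm R d n].

(* Main.v *)
Require Import Defs.
From mathcomp Require Import all_boot all_order all_algebra.
From mathcomp Require Import all_classical all_reals all_analysis.
From mathcomp Require Import measurable_realfun ring lra.
Import Order.TTheory GRing.Theory Num.Theory.
Import numFieldNormedType.Exports.
Set Implicit Arguments.
Unset Strict Implicit.
Local Open Scope classical_set_scope.
Local Open Scope ring_scope.

(** The zero algorithm has error at most 1, because a function of the unit ball
    is bounded by 1 and the cube has measure 1. The point is that n sample
    points do not help when d is large: there is a function of the unit ball
    that vanishes at all of them and has integral close to 1.

    Given sample points z_0, ..., z_(n-1) in the cube, split the coordinates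
    into n blocks by b(i) = i mod n, and consider

      f(x) = \prod_j (1 - \prod_(i : b(i) = j) q_i(x_i)),
      q_i(t) = 1 - (t - z_(b(i), i))^2 / 2.

    - f vanishes at z_j, as its factor of index j does
      ([fooling_deriv_vanish]).
    - f is in the unit ball. On the unit interval every derivative of q_i is
      bounded by 1 and q_i itself takes values in [0, 1]. The blocks are
      disjoint, so a partial derivative of f is again a product over the
      blocks: a block that is not differentiated contributes a number in
      [0, 1], and a block that is differentiated contributes minus a product of
      derivatives of the q_i ([partials_fooling], [fooling_ball]).
    - The integral of f is close to 1. Indeed f is at least 1 minus the sum over
      j of the block products, and by Tonelli the integral of such a product is
      the product of the integrals of the q_i, each at most 23/24 wherever the
      sample point lies ([integral_cap_le]). Each block has at least d %/ n
      coordinates, so the integral of f is at least 1 - n (23/24)^(d %/ n)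
      ([minimal_error_ge]), which tends to 1. *)

(** * Partial derivatives on the cube *)

Section partial_on_cube.
Context {R : realType} {d : nat}.
Implicit Types (F G : 'rV[R]_d -> R) (x : 'rV[R]_d) (i : 'I_d).

(** Some one-sided neighbourhood of 0 keeps the i-th coordinate in the unit
    interval, so that limits of difference quotients within the cube are
    unique. *)
Lemma partial_dom_proper x i : cube x ->
  ProperFilter (within (partial_dom x i) (0 : R)^').
Proof.
move=> xc; apply: Build_ProperFilter => //.
move=> [e /= e0 He].
have [x0 x1] := andP (xc i).
(* From the left half of the interval move to the right, and conversely. *)
have [h [h0 he hx]] : exists h : R,
    [/\ h != 0, `|h| < e & 0 <= x ord0 i + h <= 1].
  pose m := Num.min (e / 2) (1 / 2).
  have m0 : 0 < m by rewrite /m lt_min; apply/andP; split; lra.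
  have me : m <= e / 2 by rewrite /m ge_min lexx.
  have m1 : m <= 1 / 2 by rewrite /m ge_min lexx orbT.
  case: (leP (x ord0 i) (1 / 2)) => hx.
    by exists m; split; [lra|rewrite gtr0_norm; lra|lra].
  by exists (- m); split; [lra|rewrite normrN gtr0_norm; lra|lra].
apply: (He h) => //=; first by rewrite sub0r normrN.
move=> k; rewrite !mxE /=.
by case: eqVneq => [->|_] /=; rewrite ?mulr1 ?mulr0 ?addr0.
Qed.

(** Iterated partial derivatives are known on the cube only, where they are
    given by a formula; this lets one differentiate the formula instead, with
    an unrestricted limit. *)
Lemma partialP F G x i l : (forall z, cube z -> F z = G z) -> cube x ->
    partial_quotient G x i h @[h --> 0^'] --> l ->
  partial_derivable F x i /\ partial i F x = l.
Proof.
move=> FG xc Gl; have PF := partial_dom_proper i xc.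
have Fl : partial_quotient F x i @ within (partial_dom x i) 0^' --> l.
  apply: cvg_trans (@cvg_within_filter _ _ _ _ _ _ (partial_dom x i) Gl).
  apply: near_eq_cvg; apply: (@filterE _ (0 : R)^') => h hx.
  by rewrite /partial_quotient !FG.
split; first by apply/cvg_ex; exists l.
exact: cvg_lim Fl.
Qed.

End partial_on_cube.

(** * The factors of the fooling function *)

Section cap.
Context {R : realType}.
Implicit Types (k : nat) (y t : R).

(** The k-th derivative of the parabola t |-> 1 - (t - y) ^+ 2 / 2. *)
Definition cap k y t : R :=
  match k with
  | 0 => 1 - (t - y) ^+ 2 / 2
  | 1 => y - t
  | 2 => -1
  | _ => 0
  end.

Lemma cap_quotient k y t :
  h^-1 * (cap k y (t + h) - cap k y t) @[h --> 0^'] --> cap k.+1 y t.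
Proof.
(* The quotient is affine in h, with slope - 1 / 2 if k = 0 and 0 otherwise. *)
pose c : R := if k == 0 then 1 / 2 else 0.
have : cap k.+1 y t - c * h @[h --> (0 : R)^'] --> cap k.+1 y t - c * 0.
  apply: cvgB; first exact: cvg_cst.
  by apply: cvgM; [exact: cvg_cst|exact: nbhs_dnbhs].
rewrite mulr0 subr0; apply: cvg_trans; apply: near_eq_cvg.
near=> h; have h0 : h != 0 by near: h; exact: nbhs_dnbhs_neq.
by rewrite /c; case: k @c => [|[|[|k]]] /=; field.
Unshelve. all: by end_near.
Qed.

Lemma continuous_cap k y : continuous (cap k y).
Proof.
case: k => [|[|[|k]]] t /=.
- apply: cvgB; first exact: cvg_cst.
  apply: cvgM; last exact: cvg_cst.
  under eq_fun do rewrite expr2.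
  by apply: cvgM; (apply: cvgB; [exact: cvg_id|exact: cvg_cst]).
- by apply: cvgB; [exact: cvg_cst|exact: cvg_id].
- exact: cvg_cst.
- exact: cvg_cst.
Qed.

Lemma cap_itv y t : 0 <= y <= 1 -> 0 <= t <= 1 -> 0 <= cap 0 y t <= 1.
Proof.
move=> /andP[y0 y1] /andP[t0 t1] /=.
have : (t - y) ^+ 2 <= 1.
  by rewrite -real_normK ?num_real// exprn_ile1// ler_norml; lra.
by have := sqr_ge0 (t - y); lra.
Qed.

Lemma normr_cap_le1 k y t : 0 <= y <= 1 -> 0 <= t <= 1 -> `|cap k y t| <= 1.
Proof.
move=> y01 t01; case: k => [|k].
  by have /andP[c0 c1] := cap_itv y01 t01; rewrite ger0_norm.
move: y01 t01 => /andP[? ?] /andP[? ?].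
by case: k => [|[|k]] /=; rewrite ler_norml; apply/andP; split; lra.
Qed.

Lemma capyy y : cap 0 y y = 1. Proof. by rewrite /=; lra. Qed.
End cap.

Lemma normr_prod_le1 (R : numDomainType) (I : finType) (P : pred I)
    (F : I -> R) :
  (forall i, P i -> `|F i| <= 1) -> `|\prod_(i | P i) F i| <= 1.
Proof.
move=> F1; rewrite normr_prod; apply: prodr_ile1 => i Pi.
by rewrite normr_ge0 F1.
Qed.

(** * The fooling function and its derivatives *)

Section fooling.
Context {R : realType} {n d : nat} (b : 'I_d -> 'I_n) (y : 'I_d -> R).
Implicit Types (al : 'I_d -> nat) (x : 'rV[R]_d).

Definition block_cap al j x : R :=
  \prod_(i | b i == j) cap (al i) (y i) (x ord0 i).

(** The fooling function is the case [al = 0], and the general case is its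
    partial derivative of multi-index [al]. The indicator is the constant 1 in
    the factor of index j, which disappears as soon as one differentiates with
    respect to a coordinate of the block j. *)
Definition fooling_deriv al x : R :=
  \prod_(j < n)
    ([forall i, (b i == j) ==> (al i == 0%N)]%:R - block_cap al j x).

Lemma continuous_block_cap al j : continuous (block_cap al j).
Proof.
have := @continuous_big R _ *%R 1 (fun i => b i == j) (@mul_continuous _)
  'rV[R]_d (index_enum 'I_d) (fun i x => cap (al i) (y i) (x ord0 i)).
apply=> i _ x; apply: (@continuous_comp _ _ _ _ (cap (al i) (y i))).
  exact: coord_continuous.
exact: continuous_cap.
Qed.

Lemma continuous_fooling_deriv al : continuous (fooling_deriv al).
Proof.
have := @continuous_big R _ *%R 1 xpredT (@mul_continuous _)
  'rV[R]_d (index_enum 'I_n) (fun j x =>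
    [forall i, (b i == j) ==> (al i == 0%N)]%:R - block_cap al j x).
apply=> j _ x.
exact: (cvgB (cvg_cst (_ : R)) (@continuous_block_cap al j x)).
Qed.

(** As a function of the i-th coordinate t, the product is
    (c - cap t * B) * A with c, A and B independent of t: only the factor of
    the block of i depends on t, and it does so through one of its caps. *)
Lemma fooling_deriv_quotient al x i :
  partial_quotient (fooling_deriv al) x i h @[h --> 0^'] -->
    fooling_deriv (fun k => ((k == i) + al k)%N) x.
Proof.
pose A := \prod_(j < n | j != b i)
  ([forall k, (b k == j) ==> (al k == 0%N)]%:R - block_cap al j x).
pose B := \prod_(k | (b k == b i) && (k != i)) cap (al k) (y k) (x ord0 k).
pose c : R := [forall k, (b k == b i) ==> (al k == 0%N)]%:R.
have E h : fooling_deriv al (x + h *: delta_mx ord0 i) =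
    (c - cap (al i) (y i) (x ord0 i + h) * B) * A.
  rewrite /fooling_deriv (bigD1 (b i))//=; congr (_ * _).
    congr (_ - _); rewrite /block_cap (bigD1 i)//= !mxE !eqxx mulr1.
    congr (_ * _); apply: eq_bigr => k /andP[_ /negbTE ki].
    by rewrite !mxE ki mulr0 addr0.
  apply: eq_bigr => j jbi; congr (_ - _); apply: eq_bigr => k /eqP bk.
  rewrite !mxE eqxx; case: eqVneq => [ki|_]; last by rewrite mulr0 addr0.
  by rewrite -bk ki eqxx in jbi.
have -> : fooling_deriv (fun k => ((k == i) + al k)%N) x =
    - cap (al i).+1 (y i) (x ord0 i) * B * A.
  rewrite /fooling_deriv (bigD1 (b i))//=; congr (_ * _).
    rewrite (_ : [forall _, _] = false) ?sub0r ?mulNr; last first.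
      by apply/negbTE/forallPn; exists i; rewrite eqxx implyTb eqxx.
    congr (- _); rewrite /block_cap (bigD1 i)//= eqxx.
    by congr (_ * _); apply: eq_bigr => k /andP[_ /negbTE ->].
  apply: eq_bigr => j jbi; congr (_%:R - _).
    congr nat_of_bool; apply: eq_forallb => k; case: (b k =P j) => //= bk.
    by case: (k =P i) => // ki; rewrite -bk ki eqxx in jbi.
  apply: eq_bigr => k /eqP bk; case: eqVneq => // ki.
  by rewrite -bk ki eqxx in jbi.
have -> : partial_quotient (fooling_deriv al) x i = fun h =>
    - (h^-1 * (cap (al i) (y i) (x ord0 i + h) - cap (al i) (y i) (x ord0 i)))
      * B * A.
  apply/funext => h; rewrite /partial_quotient E.
  rewrite -[in fooling_deriv al x](addr0 x) -(scale0r (delta_mx ord0 i)) E.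
  by rewrite addr0; ring.
apply: cvgM; last exact: cvg_cst.
apply: cvgM; last exact: cvg_cst.
by apply: cvgN; exact: cap_quotient.
Qed.

Lemma partials_fooling s x : cube x ->
  partials s (fooling_deriv (fun=> 0%N)) x =
  fooling_deriv (fun k => count_mem k s) x.
Proof.
elim: s x => [//|i s IH] x xc /=.
have [_ ->] := partialP (i := i) IH xc (fooling_deriv_quotient (i := i)).
by congr (fooling_deriv _ x); apply/funext => k; rewrite eq_sym.
Qed.

Lemma Cinf_fooling : Cinf (fooling_deriv (fun=> 0%N)).
Proof.
move=> s; split.
  apply: subspace_eq_continuous (continuous_subspaceT
    (continuous_fooling_deriv (al := fun k => count_mem k s))).
  by move=> x; rewrite inE => xc; exact/esym/partials_fooling.
move=> x i xc.
exact: (partialP (@partials_fooling s) xc (fooling_deriv_quotient (i := i))).1.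
Qed.

Hypothesis y01 : forall i, 0 <= y i <= 1.

Lemma block_cap0_itv j x : cube x -> 0 <= block_cap (fun=> 0%N) j x <= 1.
Proof.
move=> xc; apply/andP; split.
  by apply: prodr_ge0 => i _; have /andP[] := cap_itv (y01 i) (xc i).
by apply: prodr_ile1 => i _; exact: cap_itv.
Qed.

(** A block that is not differentiated gives 1 - p with p in [0, 1], for which
    the bounds of the caps by 1 in absolute value would not suffice; any other
    gives - p. *)
Lemma normr_fooling_deriv_le1 al x : cube x -> `|fooling_deriv al x| <= 1.
Proof.
move=> xc; apply: normr_prod_le1 => j _.
have [/forallP al0|_] := boolP [forall i, (b i == j) ==> (al i == 0%N)].
  have -> : block_cap al j x = block_cap (fun=> 0%N) j x.
    by apply: eq_bigr => i bi; have := al0 i; rewrite bi => /eqP ->.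
  by have := block_cap0_itv j xc; rewrite /= ler_norml; lra.
rewrite sub0r normrN; apply: normr_prod_le1 => i _.
exact: normr_cap_le1.
Qed.

Lemma fooling_ball : Cinf_ball (fooling_deriv (fun=> 0%N)).
Proof.
split; first exact: Cinf_fooling.
apply: ge_ereal_sup => _ [[al x] /= xc <-]; rewrite lee_fin /multi_partial.
by rewrite partials_fooling// normr_fooling_deriv_le1.
Qed.

Lemma fooling0E x :
  fooling_deriv (fun=> 0%N) x = \prod_(j < n) (1 - block_cap (fun=> 0%N) j x).
Proof.
apply: eq_bigr => j _; rewrite (_ : [forall _, _] = true)//.
by apply/forallP => i; rewrite eqxx implybT.
Qed.

(** This is the Bernoulli-Weierstrass inequality; it reduces the integral of the
    fooling function to integrals of products over the coordinates. *)
Lemma fooling_ge x : cube x ->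
  1 - \sum_(j < n) block_cap (fun=> 0%N) j x <= fooling_deriv (fun=> 0%N) x.
Proof.
move=> xc; rewrite fooling0E.
(* The induction also needs the sum to be nonnegative. *)
suff [] : 0 <= \sum_(j < n) block_cap (fun=> 0%N) j x /\
    1 - \sum_(j < n) block_cap (fun=> 0%N) j x <=
    \prod_(j < n) (1 - block_cap (fun=> 0%N) j x) by [].
elim/big_rec2 : _ => [|j u v _ [u0 IH]]; first by rewrite subr0.
by have /andP[B0 B1] := block_cap0_itv j xc; split; nra.
Qed.

End fooling.

Lemma fooling_deriv_vanish (R : realType) n d (b : 'I_d -> 'I_n)
    (z : 'I_n -> 'rV[R]_d) j :
  fooling_deriv b (fun i => z (b i) ord0 i) (fun=> 0%N) (z j) = 0.
Proof.
rewrite fooling0E (bigD1 j)//= /block_cap big1 ?subrr ?mul0r//.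
by move=> i /eqP ->; exact: capyy.
Qed.

(** * Integrals of products over the coordinates *)

Section tuple_integral.
Context {R : realType}.
Local Open Scope ereal_scope.

Lemma measurable_prod_tnth d (phi : 'I_d -> R -> R) :
    (forall i, measurable_fun setT (phi i)) ->
  measurable_fun [set: d.-tuple R] (fun t => (\prod_i phi i (tnth t i))%R).
Proof.
move=> mphi; apply: measurable_prod => i _.
by apply: measurableT_comp (mphi i) _; exact: measurable_tnth.
Qed.

Lemma integral_prod_tnth d (phi : 'I_d -> R -> R) :
    (forall i, measurable_fun setT (phi i)) -> (forall i t, (0 <= phi i t)%R) ->
  \int[@lebesgue_tuple R d]_t (\prod_i phi i (tnth t i))%:E =
  \prod_i \int[lebesgue_measure]_x (phi i x)%:E.
Proof.
elim: d phi => [|d IH] phi mphi phi0.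
  rewrite [LHS](integral_dirac ([tuple] : 0.-tuple R) measurableT).
    by rewrite !big_ord0 diracT mul1e.
  by apply/measurable_EFinP; exact: measurable_prod_tnth.
have mpr := measurable_prod_tnth mphi.
have mEpr : measurable_fun setT
    (EFin \o (fun t : d.+1.-tuple R => (\prod_i phi i (tnth t i))%R)).
  exact/measurable_EFinP.
rewrite [LHS](ge0_integral_pushforward (@measurable_tuple_cons R d)
  (lebesgue_measure \x @lebesgue_tuple R d) measurableT mEpr); last first.
  by move=> t _; rewrite lee_fin prodr_ge0.
rewrite preimage_setT.
rewrite (fubini_tonelli1 (m1 := lebesgue_measure)
  (m2 := @lebesgue_tuple R d)); last 2 first.
- exact: measurableT_comp mEpr (@measurable_tuple_cons R d).
- by move=> p; rewrite lee_fin prodr_ge0.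
have IHl := IH (fun i => phi (lift ord0 i)) (fun i => mphi _) (fun i => phi0 _).
rewrite big_ord_recl -IHl.
set J := \int[lebesgue_tuple d]_t _.
transitivity (\int[lebesgue_measure]_x ((phi ord0 x)%:E * J)).
  apply: eq_integral => x _.
  rewrite /fubini_F -ge0_integralZl_EFin//; last 2 first.
  - by move=> t _; rewrite lee_fin prodr_ge0.
  - apply/measurable_EFinP.
    exact: (measurable_prod_tnth (fun i => mphi (lift ord0 i))).
  apply: eq_integral => t _ /=; rewrite -EFinM big_ord_recl tnth0.
  by congr (_ * _)%:E; apply: eq_bigr => i _; rewrite /tuple_cons tnthS.
rewrite ge0_integralZr//.
- by move/measurable_EFinP: (mphi ord0).
- by move=> x _; rewrite lee_fin.
- by apply: integral_ge0 => t _; rewrite lee_fin prodr_ge0.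
Qed.

Lemma preimage_cubeE d : row_of_tuple @^-1` cube =
  [set t : d.-tuple R | forall i, `[0%R, 1%R]%classic (tnth t i)].
Proof.
apply/seteqP; split => t /= tc i; have := tc i.
  by rewrite mxE in_itv.
by rewrite mxE in_itv.
Qed.

Lemma measurable_preimage_cube d :
  measurable (row_of_tuple @^-1` cube : set (d.-tuple R)).
Proof.
rewrite preimage_cubeE [X in measurable X](_ : _ = \bigcap_(i in [set: 'I_d])
    ((@tnth _ R ^~ i) @^-1` `[0%R, 1%R]%classic)).
  apply: fin_bigcap_measurable => // i _.
  rewrite -[X in measurable X]setTI.
  by apply: measurable_tnth => //; exact: measurable_itv.
by apply/seteqP; split=> t /= h i; [move=> _; exact: h|exact: (h i I)].
Qed.

(** The indicator of the cube is a product over the coordinates as well. *)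
Lemma integral_cube_prod d (g : 'I_d -> R -> R) :
    (forall i, measurable_fun setT (g i)) ->
    (forall i t, (0 <= t <= 1)%R -> (0 <= g i t)%R) ->
  \int[@lebesgue_tuple R d]_(t in row_of_tuple @^-1` cube)
    (\prod_i g i (tnth t i))%:E =
  \prod_i \int[lebesgue_measure]_(x in `[0%R, 1%R]) (g i x)%:E.
Proof.
move=> mg g0; rewrite preimage_cubeE.
transitivity (\prod_i \int[lebesgue_measure]_x ((g i \_ `[0%R, 1%R]) x)%:E);
  last first.
  by apply: eq_bigr => i _; rewrite [RHS]integral_mkcond restrict_EFin.
rewrite -integral_prod_tnth => [||i t]; last 2 first.
- move=> i.
  have [mgr _] := measurable_restrictT (g i) (measurable_itv `[0%R, 1%R]).
  by apply: mgr; exact: measurable_funTS.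
- by rewrite patchE; case: ifPn => //; rewrite inE /= in_itv /=; exact: g0.
rewrite integral_mkcond restrict_EFin; apply: eq_integral => t _ /=.
congr EFin; rewrite patchE; case: ifPn => [|].
  rewrite inE /= => tc; apply: eq_bigr => i _.
  by rewrite patchE ifT// inE; exact: tc.
rewrite notin_setE /= => /existsNP[i ti].
by rewrite (bigD1 i)//= patchE ifF ?mul0r//; apply/negbTE; rewrite notin_setE.
Qed.

Lemma lebesgue_tuple_cube d :
  @lebesgue_tuple R d (row_of_tuple @^-1` cube) = 1.
Proof.
rewrite preimage_cubeE (@lebesgue_tuple_box R d (fun=> `[0%R, 1%R]%classic)).
  rewrite big1// => i _.
  by rewrite lebesgue_measure_itv/= lte_fin ltr01 sube0.
by move=> i; exact: measurable_itv.
Qed.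

(** The mean of (t - y) ^+ 2 over the unit interval is smallest at the midpoint
    y = 1 / 2, where it equals 1 / 12. *)
Lemma integral_cap_le (y : R) :
  \int[lebesgue_measure]_(t in `[0%R, 1%R]) (cap 0 y t)%:E <= (23 / 24)%:E.
Proof.
pose F (t : R) := (t - (t - y) ^+ 3 / 6)%R.
have dF t : is_derive t (1 : R)%R F (cap 0 y t).
  apply: is_derive_eq.
  by rewrite /= !scaler0 /GRing.scale /=; field.
have cF : continuous F.
  move=> t; apply: differentiable_continuous; apply/derivable1_diffP.
  exact: ex_derive.
have -> : \int[lebesgue_measure]_(t in `[0%R, 1%R]) (cap 0 y t)%:E =
    (F 1%R)%:E - (F 0%R)%:E.
  apply: continuous_FTC2 => //.
  - by apply: continuous_subspaceT; exact: continuous_cap.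
  - split.
    + by move=> t _; exact: ex_derive.
    + by apply: cvg_at_right_filter; exact: cF.
    + by apply: cvg_at_left_filter; exact: cF.
  - by move=> t _; rewrite derive1E; exact: derive_val.
rewrite -EFinB lee_fin /F.
(* y ^+ 3 + (1 - y) ^+ 3 = 3 * (y - 1 / 2) ^+ 2 + 1 / 4 *)
have := sqr_ge0 (y - 1 / 2); lra.
Qed.
End tuple_integral.

(** * Bounds on the integral over the cube *)

Section cube_integral_bounds.
Context {R : realType}.
Local Open Scope ereal_scope.

(** For nonnegative functions the integral is a supremum over the simple
    functions below, which is monotone without measurability. The unit ball is
    defined by continuity for the topology of the row vectors, and this makes
    it possible to bound the integrals of its members without comparing the
    Borel sets of that topology with the product sigma-algebra. *)
Lemma ge0_le_integral_nonmeasurable dT (T : measurableType dT)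
    (mu : {measure set T -> \bar R}) (D : set T) (f g : T -> \bar R) :
    (forall t, D t -> 0 <= f t) -> (forall t, D t -> f t <= g t) ->
  \int[mu]_(t in D) f t <= \int[mu]_(t in D) g t.
Proof.
move=> f0 fg; have g0 t : D t -> 0 <= g t.
  by move=> Dt; exact: le_trans (f0 _ Dt) (fg _ Dt).
rewrite !ge0_integralE//; apply: ereal_sup_le => _ [h /= hf <-].
exists h => // t; apply: le_trans (hf t) _; rewrite !patchE.
by case: ifPn => //; rewrite inE => /fg.
Qed.

Lemma ge0_integral_cube_le1 d (f : d.-tuple R -> \bar R) :
    (forall t, (row_of_tuple @^-1` cube) t -> 0 <= f t <= 1) ->
  0 <= \int[@lebesgue_tuple R d]_(t in row_of_tuple @^-1` cube) f t <= 1.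
Proof.
move=> f01; apply/andP; split.
  by apply: integral_ge0 => t /f01 /andP[].
rewrite -[leRHS](@lebesgue_tuple_cube R d) -[leRHS]mul1e.
rewrite -integral_cst; last first.
  exact: measurable_preimage_cube.
by apply: ge0_le_integral_nonmeasurable => t /f01 /andP[].
Qed.

(** The integrals of the positive and the negative part both lie in [0, 1]. *)
Lemma normr_cube_integral_le1 d (f : 'rV[R]_d -> R) :
  (forall x, cube x -> (`|f x| <= 1)%R) -> (`|cube_integral f| <= 1)%R.
Proof.
move=> f1; rewrite /cube_integral /Rintegral integralE.
set P := integral _ _ _; set N := integral _ _ _.
have bnd t : (row_of_tuple @^-1` cube) t ->
    -1 <= (f (row_of_tuple t))%:E <= 1.
  by move=> /f1; rewrite ler_norml -!lee_fin.
have /andP[P0 P1] : 0 <= P <= 1.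
  apply: ge0_integral_cube_le1 => t /bnd /andP[_ ?].
  by rewrite funeposE /= le_max lexx orbT ge_max lee01 andbT.
have /andP[N0 N1] : 0 <= N <= 1.
  apply: ge0_integral_cube_le1 => t /bnd /andP[? _].
  rewrite funenegE le_max lexx orbT ge_max lee01 andbT.
  by rewrite leeNl.
move: P P0 P1 N N0 N1 {f1 bnd} => [p| |]// P0 P1 [q| |]// N0 N1.
by rewrite /=; move: P0 P1 N0 N1; rewrite !lee_fin ler_norml; lra.
Qed.

Lemma cube_integral_fooling_ge n d (b : 'I_d -> 'I_n) (y : 'I_d -> R) :
    (forall i, 0 <= y i <= 1)%R ->
  (1 - \sum_(j < n) (23 / 24) ^+ #|[pred i | b i == j]| <=
   cube_integral (fooling_deriv b y (fun=> 0%N)))%R.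
Proof.
move=> y01; pose D : set (d.-tuple R) := row_of_tuple @^-1` cube.
have mD : measurable D := @measurable_preimage_cube R d.
pose f t := fooling_deriv b y (fun=> 0%N) (@row_of_tuple R d t).
pose g j t := block_cap b y (fun=> 0%N) j (@row_of_tuple R d t).
have f0 t : D t -> (0 <= f t)%R.
  move=> Dt; rewrite /f fooling0E prodr_ge0// => j _.
  by have /andP[_] := block_cap0_itv b y01 j Dt; lra.
have f1 t : D t -> (f t <= 1)%R.
  by move=> Dt; have := normr_fooling_deriv_le1 b y01 (fun=> 0%N) Dt;
    rewrite ler_norml => /andP[].
have g0 j t : D t -> (0 <= g j t)%R.
  by move=> Dt; have /andP[] := block_cap0_itv b y01 j Dt.
have gE j t : g j t =
    (\prod_i (if b i == j then cap 0 (y i) (tnth t i) else 1))%R.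
  by rewrite /g /block_cap big_mkcond; apply: eq_bigr => i _; rewrite mxE.
have mcap (j : 'I_n) i : measurable_fun setT
    (fun t : R => if b i == j then cap 0 (y i) t else 1%R).
  case: (b i == j); last exact: measurable_cst.
  by apply: continuous_measurable_fun; exact: continuous_cap.
have mg j : measurable_fun setT (g j).
  rewrite (funext (gE j)); exact: measurable_prod_tnth (mcap j).
have mf : measurable_fun setT f.
  rewrite /f; under eq_fun do rewrite fooling0E.
  apply: measurable_prod => j _.
  exact: measurable_funB (measurable_cst _) (mg j).
have int_g j : \int[@lebesgue_tuple R d]_(t in D) (g j t)%:E <=
    ((23 / 24) ^+ #|[pred i | b i == j]|)%:E.
  under eq_integral do rewrite gE.
  rewrite (integral_cube_prod (mcap j)); last first.
    move=> i t t01; case: (b i == j) => //.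
    by have /andP[] := cap_itv (y01 i) t01.
  rewrite -prodr_const -prodEFin [leRHS]big_mkcond.
  suff /andP[] : 0 <= \prod_i \int[lebesgue_measure]_(t in `[0%R, 1%R])
      (if b i == j then cap 0 (y i) t else 1%R)%:E <=
    \prod_i (if i \in [pred i | b i == j] then (23 / 24)%:E else 1) by [].
  elim/big_ind2 : _ => [|p p' q q' /andP[? ?] /andP[? ?]|i _].
  - by rewrite lee01 lexx.
  - by rewrite mule_ge0//= lee_pmul.
  apply/andP; split.
    apply: integral_ge0 => t; rewrite /= in_itv /= => t01; rewrite lee_fin.
    case: (b i == j) => //.
    by have /andP[] := cap_itv (y01 i) t01.
  rewrite inE; case: (b i == j); first exact: integral_cap_le.
  rewrite integral_cst; last exact: measurable_itv.
  by rewrite mul1e /= lebesgue_measure_itv/= lte_fin ltr01 sube0.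
pose If := \int[@lebesgue_tuple R d]_(t in D) (f t)%:E.
have /andP[If0 If1] : 0 <= If <= 1.
  by apply: ge0_integral_cube_le1 => t Dt; rewrite !lee_fin f0 ?f1.
have : 1 <= If + \sum_(j < n) \int[@lebesgue_tuple R d]_(t in D) (g j t)%:E.
  rewrite -ge0_integral_sum//; last first.
    by move=> j; apply/measurable_EFinP; exact: measurable_funTS.
  rewrite -ge0_integralD//; last 3 first.
  - by apply/measurable_EFinP; exact: measurable_funTS.
  - by move=> t Dt; apply: sume_ge0 => j _; rewrite lee_fin g0.
  - apply: emeasurable_sum => j.
    by apply/measurable_EFinP; exact: measurable_funTS.
  rewrite -[leLHS](@lebesgue_tuple_cube R d) -[leLHS]mul1e -integral_cst//.
  apply: ge0_le_integral_nonmeasurable => // t Dt.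
  rewrite sumEFin -EFinD lee_fin.
  by have := fooling_ge b y01 Dt; rewrite -/(f t) -lerBlDr.
have -> : cube_integral (fooling_deriv b y (fun=> 0%N)) = fine If by [].
move: If If0 If1 => [r| |]// _ _ h /=; rewrite -lee_fin EFinB.
rewrite leeBlDr//; apply: (le_trans h); rewrite leeD2l// -sumEFin.
by apply: lee_sum => j _; exact: int_g.
Qed.
End cube_integral_bounds.

(** The numbers k * n + j for k < d %/ n are below d and congruent to j. *)
Lemma card_residue n d (j : 'I_n) (hn : (0 < n)%N) :
  (d %/ n <= #|[pred i : 'I_d | (i %% n)%N == j]|)%N.
Proof.
have lt_d (k : 'I_(d %/ n)) : (k * n + j < d)%N.
  apply: (@leq_trans (k.+1 * n)); first by rewrite mulSn addnC ltn_add2r.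
  by apply: leq_trans (leq_divM d n); rewrite leq_mul2r ltn_ord orbT.
pose h (k : 'I_(d %/ n)) := Ordinal (lt_d k).
have h_inj : injective h.
  move=> k l [] /eqP; rewrite eqn_add2r eqn_pmul2r// => /eqP kl.
  exact/val_inj.
rewrite -[leqLHS]card_ord -(card_codom h_inj); apply: subset_leq_card.
apply/fintype.subsetP => _ /codomP[k ->].
by rewrite inE /= modnMDl modn_small.
Qed.

(** * The limit of the minimal errors *)

Lemma minimal_error_le1 (R : realType) n d : (minimal_error R n d <= 1)%E.
Proof.
apply: (@le_trans _ _ (@worst_case_error R d (fun=> 0))).
  apply: ereal_inf_lbound; exists (fun=> 0) => //.
  exists (fun=> 0), (fun=> 0); split.
    by move=> j i; rewrite mxE lexx ler01.
  by apply/funext => f; rewrite big1// => j _; rewrite mul0r.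
apply: ge_ereal_sup => _ [f [_ f1] <-].
rewrite subr0 lee_fin; apply: normr_cube_integral_le1 => x xc.
rewrite -lee_fin; apply: le_trans f1; apply: ereal_sup_ubound.
exists (fun=> 0%N, x) => //=; rewrite /multi_partial.
by rewrite (_ : flatten _ = [::])//; elim: (enum _).
Qed.

(** Any linear algorithm returns 0 on the function that vanishes at all its
    sample points, so its error is at least the integral of this function. *)
Lemma minimal_error_ge (R : realType) n d : (0 < n)%N ->
  ((1 - n%:R * (23 / 24) ^+ (d %/ n))%:E <= minimal_error R n d)%E.
Proof.
move=> hn; apply: le_ereal_inf_tmp => _ [_ [a [z [zc ->]]] <-].
pose b (i : 'I_d) : 'I_n := Ordinal (ltn_pmod i hn).
pose f := fooling_deriv b (fun i => z (b i) ord0 i) (fun=> 0%N).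
have z01 i : 0 <= z (b i) ord0 i <= 1 by exact: zc.
apply: le_ereal_sup_tmp; exists `|cube_integral f|%:E.
  exists f; first exact: fooling_ball.
  rewrite big1 ?subr0// => j _.
  by rewrite /f fooling_deriv_vanish mulr0.
rewrite lee_fin; apply: le_trans (ler_norm _).
rewrite /f; apply: le_trans (cube_integral_fooling_ge b z01).
rewrite lerB//.
have -> : n%:R * (23 / 24 : R) ^+ (d %/ n) =
    \sum_(j < n) (23 / 24) ^+ (d %/ n).
  by rewrite sumr_const card_ord mulr_natl.
apply: ler_sum => j _; apply: ler_wiXn2l; [lra|lra|].
apply: leq_trans (card_residue d j hn) _.
by apply: subset_leq_card; apply/fintype.subsetP => i; rewrite !inE.
Qed.

Theorem theorem2p1 (R : realType) (n : nat) (hn : (0 < n)%N) :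
  minimal_error R n d @[d --> \oo] --> 1%E.
Proof.
apply: (@squeeze_cvge _ _ _ _
  (fun d => (1 - n%:R * (23 / 24) ^+ (d %/ n))%:E) _ (fun=> 1%E)).
- by apply: nearW => d; rewrite minimal_error_ge// minimal_error_le1.
- apply: cvg_EFin; first exact: nearW.
  rewrite -[X in _ --> X]subr0; apply: cvgB; first exact: cvg_cst.
  rewrite -[X in _ --> X](mulr0 n%:R); apply: cvgM; first exact: cvg_cst.
  apply: (@cvg_comp _ _ _ (fun d => d %/ n)%N
    (fun k => (23 / 24 : R) ^+ k) _ \oo).
    apply/cvgnyPge => A; near=> d.
    by rewrite leq_divRL//; near: d; exact: nbhs_infty_ge.
  by apply: cvg_expr; rewrite ger0_norm; lra.
- exact: cvg_cst.
Unshelve. all: by end_near.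
Qed.
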